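(* Let $S$ be a finite set of points in $\mathbb{R}^d$ and $z \in \mathbb{R}^d \setminus S$. Suppose that $z$ is in general position with respect to $S$. Then $|\mathcal{A}(S)| \le d\,|\mathcal{C}(S)| + 1$.
   Context: For $X \subseteq S$, $\mathrm{conv}(X)$ is the convex hull of $X$ and $R(X)$ is the smallest affine subspace of $\mathbb{R}^d$ containing $X$, with $\dim R(X)$ its affine dimension. A set $X \subseteq S$ is $z$-containing if $z$ lies in the interior of $\mathrm{conv}(X)$, and $z$-avoiding otherwise. A $z$-containing set is minimal if it has no proper $z$-containing subset; a $z$-avoiding $X\subseteq S$ is maximal in $S$ if no $z$-avoiding subset of $S$ properly contains $X$. $\mathcal{C}(S)$ is the set of minimal $z$-containing subsets of $S$ and $\mathcal{A}(S)$ is the set of maximal $z$-avoiding subsets of $S$. The point $z$ is in general position with respect to $S$ if for every $X \subseteq S$ with $\dim R(X) < d$ we have $z \notin R(X)$. *)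

(* Defs.v *)
From HB Require Import structures.
From mathcomp Require Import all_boot all_order all_algebra finmap.
From mathcomp Require Import boolp classical_sets functions reals topology.
From mathcomp Require Import normedtype convex.

Set Implicit Arguments.
Unset Strict Implicit.
Unset Printing Implicit Defensive.

Import Order.TTheory GRing.Theory Num.Theory.
Import numFieldNormedType.Exports.

Local Open Scope classical_set_scope.
Local Open Scope ring_scope.

Section Defs.
Variables (R : realType) (d : nat).
Local Notation V := 'rV[R]_d.

Definition conv_hull (X : set V) : set V :=
  smallest (@convex_set R V) X.

Definition translate (p : V) (U : {vspace V}) : set V :=
  [set p + u | u in [set` U]].

(* The empty set counts as an affine subspace, so that it is its own affine
   hull. *)
Definition affine_subspace (A : set V) : Prop :=
  A = set0 \/ exists p U, A = translate p U.

Definition affine_hull (X : set V) : set V := smallest affine_subspace X.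

(* [U] is determined by [translate p U]; the default [0%VS] is returned only
   when [A] is not a nonempty affine subspace. *)
Definition direction (A : set V) : {vspace V} :=
  xget 0%VS [set U | exists p, A = translate p U].

Definition affine_dim (A : set V) : int :=
  if A == set0 then - 1 else (\dim (direction A))%:Z.

Definition z_containing (z : V) (X : {fset V}) : Prop :=
  interior (conv_hull [set` X]) z.

Definition z_avoiding (z : V) (X : {fset V}) : Prop := ~ z_containing z X.

Definition minimal_containing (z : V) (X : {fset V}) : Prop :=
  z_containing z X /\ forall Y : {fset V}, (Y `<` X)%fset -> ~ z_containing z Y.

Definition maximal_avoiding (z : V) (S X : {fset V}) : Prop :=
  z_avoiding z X /\
  forall Y : {fset V}, (Y `<=` S)%fset -> (X `<` Y)%fset -> ~ z_avoiding z Y.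

Definition minimal_containing_sets (z : V) (S : {fset V}) : {fset {fset V}} :=
  [fset X in fpowerset S | `[< minimal_containing z X >]]%fset.

Definition maximal_avoiding_sets (z : V) (S : {fset V}) : {fset {fset V}} :=
  [fset X in fpowerset S | `[< maximal_avoiding z S X >]]%fset.

Definition general_position (z : V) (S : {fset V}) : Prop :=
  forall X : {fset V}, (X `<=` S)%fset ->
    affine_dim (affine_hull [set` X]) < d%:Z -> ~ affine_hull [set` X] z.

End Defs.

(* Main.v *)
Require Import Defs.
From mathcomp Require Import all_boot all_order all_algebra finmap.
From mathcomp Require Import boolp classical_sets functions reals topology.
From mathcomp Require Import normedtype convex.
From mathcomp Require Import interval_inference.
From mathcomp Require Import zify ring lra.

(** By general position, a subset of [S] is z-containing iff some nontrivial
nonnegative combination of the vectors [x - z] over it vanishes, and the minimal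
z-containing sets are simplices with [d + 1] vertices. Let [X] be maximal
z-avoiding and [p \in S] outside [X]. Among the simplices [T] of [p |` X] around
[z], take the one in which [z] has the smallest barycentric coordinate at [p];
then [X] is the set of points of [S] on or beyond the hyperplane spanned by the
facet [T `\ p], as seen from [z]. Hence, for each [p], at most as many maximal
z-avoiding sets miss [p] as there are minimal z-containing sets through [p], and
the bound follows by double counting over [p]. *)

Set Implicit Arguments.
Unset Strict Implicit.
Unset Printing Implicit Defensive.

Import Order.TTheory GRing.Theory Num.Theory.
Import numFieldNormedType.Exports.

Local Open Scope fset_scope.
Local Open Scope ring_scope.

(** * Counting in finite set systems *)

Lemma mem_fset_sep (K : choiceType) (A : {fset K}) (P : pred K) x :
  (x \in [fset y in A | P y]) = (x \in A) && P x.
Proof. by rewrite !inE. Qed.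

Lemma sum_mem_fset (K : choiceType) (A : {fset K}) (P : pred K) :
  (\sum_(x <- A) P x)%N = #|` [fset x in A | P x]|.
Proof.
rewrite card_fset_sum1 [RHS]big_fset /= [RHS]big_mkcond /=.
by apply: eq_bigr => x _; case: (P x).
Qed.

(* [L] is the intersection of [C]: the sets [S `\ q] with [q \in L] are
   avoiding, and any other member of [A] contains [L] and misses at least two
   points of [S], which makes the double counting gain a factor two on it. *)
Lemma card_maximal_avoiding_le (K : choiceType) (d : nat) (S : {fset K})
    (A C : {fset {fset K}}) :
  (0 < d)%N ->
  (forall T, T \in C -> T `<=` S /\ #|` T| = d.+1) ->
  (forall X, X \in A -> X `<=` S) ->
  (forall X T, X \in A -> T \in C -> ~~ (T `<=` X)) ->
  (forall X Y, X \in A -> Y `<=` S -> X `<=` Y ->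
    (forall T, T \in C -> ~~ (T `<=` Y)) -> X = Y) ->
  (forall q, q \in S ->
    \sum_(X <- A) (q \notin X) <= \sum_(T <- C) (q \in T))%N ->
  (#|` A| <= d * #|` C| + 1)%N.
Proof.
move=> d0 hC hA hAC hmax hq.
have [C0|[T0 T0C]] := fset_0Vmem C.
  have -> : (d * #|` C| + 1 = #|` [fset S]|)%N by rewrite C0 cardfs0 cardfs1; lia.
  apply: fsubset_leq_card; apply/fsubsetP => X XA; rewrite inE; apply/eqP.
  by apply: hmax => //; [exact: hA|move=> T; rewrite C0 inE].
pose L := [fset q in S | all (fun T : {fset K} => q \in T) C].
have LP q : q \in L -> forall T, T \in C -> q \in T.
  by rewrite !inE /= => /andP[_ /allP qC] T /qC.
pose I := [fset S `\ q | q in L].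
pose f (X : {fset K}) := (\sum_(q <- S `\` L) (q \notin X))%N.
have fge X : X \in A -> (2 <= (X \in I) * 2 + f X)%N.
  move=> XA; case: (boolP (X \in I)) => // XI; rewrite mul0n add0n.
  have LX : L `<=` X.
    apply/fsubsetP => p pL; apply: contraT => pX.
    case/negP: XI; apply/imfsetP; exists p => //=.
    apply: hmax => //; first exact: fsubsetDl.
      apply/fsubsetP => x xX; rewrite !inE (fsubsetP (hA _ XA)) // andbT.
      by apply: contraNneq pX => <-.
    move=> T TC; apply/negP => /fsubsetP /(_ p (LP _ pL _ TC)).
    by rewrite !inE eqxx.
  have -> : f X = #|` S `\` X|.
    rewrite /f sum_mem_fset; congr (size (enum_fset _)).
    apply/fsetP => x; rewrite mem_fset_sep !in_fsetD.
    case: (boolP (x \in X)) => xX /=; first by rewrite andbF.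
    by rewrite andbT; case: (boolP (x \in L)) => // /(fsubsetP LX); rewrite (negPf xX).
  (* If [X] misses only [p], each member of [C] contains [p], since otherwise it would lie in [X];
     hence [p] is in [L] and [X] is in [I]. *)
  case E : #|` S `\` X| => [|[|n]] //.
    have /negP := hAC _ _ XA T0C; case.
    move/cardfs0_eq/eqP: E; rewrite fsetD_eq0; apply: fsubset_trans.
    by case: (hC _ T0C).
  move/eqP/cardfs1P: E => [p Ep].
  have pS : p \in S `\` X by rewrite Ep inE.
  case/negP: XI; apply/imfsetP; exists p; rewrite /=; last first.
    by rewrite -Ep fsetDK // hA.
  rewrite !inE /=; move: pS; rewrite !inE => /andP[pX ->] /=.
  apply/allP => T TC; apply: contraT => pT.
  case/negP: (hAC _ _ XA TC); apply/fsubsetP => x xT.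
  apply: contraT => xX; have : x \in S `\` X.
    by rewrite !inE xX (fsubsetP (hC _ TC).1).
  by rewrite Ep inE => /eqP xp; rewrite xp (negPf pT) in xT.
have I_le : (\sum_(X <- A) (X \in I) <= #|` L|)%N.
  rewrite sum_mem_fset; apply: (@leq_trans #|` I|); last exact: leq_imfset_card.
  by apply: fsubset_leq_card; apply/fsubsetP => X; rewrite !inE /= => /andP[].
have LT T : T \in C -> L `<=` T by move=> TC; apply/fsubsetP => q /LP; apply.
have f_le : (\sum_(X <- A) f X <= #|` C| * (d.+1 - #|` L|))%N.
  rewrite exchange_big /=.
  apply: (@leq_trans (\sum_(q <- S `\` L) \sum_(T <- C) (q \in T))%N).
    rewrite big_seq [leqRHS]big_seq; apply: leq_sum => q.
    by rewrite !inE => /andP[_ /hq].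
  rewrite exchange_big /= (card_fset_sum1 C) big_distrl /= big_seq [leqRHS]big_seq.
  apply: leq_sum => T TC; rewrite sum_mem_fset mul1n -(hC _ TC).2.
  rewrite -cardfsDS ?LT //; apply: fsubset_leq_card; apply/fsubsetP => x.
  by rewrite !inE /= => /andP[/andP[-> _] ->].
have : (#|` A| * 2 <= \sum_(X <- A) ((X \in I) * 2 + f X))%N.
  rewrite (card_fset_sum1 A) big_distrl /= big_seq [leqRHS]big_seq.
  by apply: leq_sum => X /fge; rewrite mul1n.
rewrite big_split /= -big_distrl /=.
have Ld : (#|` L| <= d.+1)%N by rewrite -(hC _ T0C).2 fsubset_leq_card ?LT.
have C_gt0 : (0 < #|` C|)%N by rewrite cardfs_gt0; apply/fset0Pn; exists T0.
(* What remains is [2 * k + c * (d.+1 - k) <= 2 * (d * c + 1)]. The left side is affine in [k], so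
   the ends decide: [k = 0] uses [0 < d], and [k = d.+1] uses [0 < c]. *)
move: I_le f_le Ld C_gt0; move: (\sum_(X <- A) _)%N (\sum_(X <- A) _)%N => u v.
move: #|` L| #|` C| #|` A| => k c a; nia.
Qed.

Lemma fset_argmax (R : realDomainType) (K : choiceType) (F : {fset K})
    (g : K -> R) (x0 : K) :
  x0 \in F -> exists2 x, x \in F & forall y, y \in F -> g y <= g x.
Proof.
move=> x0F; case: (arg_maxP (fun x : F => g (val x)) (erefl : xpredT [` x0F])).
move=> x _ hx; exists (val x); first exact: valP.
by move=> y yF; exact: (hx [` yF]).
Qed.

(** * Positive linear dependences *)

Section PositiveDependence.
Variables (R : realFieldType) (V : vectType R) (S : {fset V}) (z : V).
Implicit Types (T X Y : {fset V}) (a c : V -> R).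

Definition comb a : V := \sum_(x <- S) a x *: (x - z).
Definition total a : R := \sum_(x <- S) a x.
Definition supported X a := forall x, x \notin X -> a x = 0.
Definition posdep X c :=
  [/\ forall x, 0 <= c x, supported X c, comb c = 0 & exists x, 0 < c x].
Definition dependent X := exists c, posdep X c.
Definition mindep T :=
  dependent T /\ forall Y, Y `<` T -> ~ dependent Y.

Lemma combDZ k a c : comb (fun x => a x + k * c x) = comb a + k *: comb c.
Proof.
rewrite /comb scaler_sumr -big_split /=.
by apply: eq_bigr => x _; rewrite scalerDl scalerA.
Qed.

Lemma totalDZ k a c : total (fun x => a x + k * c x) = total a + k * total c.
Proof. by rewrite /total mulr_sumr -big_split. Qed.

Lemma comb_indicator x : x \in S -> comb (fun y => (y == x)%:R) = x - z.
Proof.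
move=> xS; rewrite /comb (big_fsetD1 x) //= eqxx scale1r big_seq big1 ?addr0 //.
by move=> y; rewrite !inE => /andP[/negPf -> _]; rewrite scale0r.
Qed.

Lemma total_indicator x : x \in S -> total (fun y => (y == x)%:R) = 1.
Proof.
move=> xS; rewrite /total (big_fsetD1 x) //= eqxx big_seq big1 ?addr0 // => y.
by rewrite !inE => /andP[/negPf -> _].
Qed.

Lemma supportedS X Y a : X `<=` Y -> supported X a -> supported Y a.
Proof. by move=> /fsubsetP XY sa x xY; apply: sa; apply: contra xY => /XY. Qed.

Lemma supported_mem X a x : supported X a -> a x != 0 -> x \in X.
Proof. by move=> sa; apply: contra_neqT => /sa. Qed.

Lemma dependentS X Y : X `<=` Y -> dependent X -> dependent Y.
Proof.
move=> XY [c [c0 sc cc cp]]; exists c; split=> //; exact: supportedS sc.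
Qed.

Lemma dependent_mindep X : dependent X -> exists2 T, T `<=` X & mindep T.
Proof.
have [n] := ubnP #|` X|; elim: n X => // n IH X; rewrite ltnS => Xn dX.
have [mX|] := pselect (mindep X); first by exists X.
move=> /not_andP[//|/existsNP[Y /not_implyP[YX /contrapT dY]]].
have [||T TY mT] := IH Y => //.
  exact: leq_trans (fproper_ltn_card YX) Xn.
by exists T => //; apply: fsubset_trans TY (fproper_sub YX).
Qed.

(** The ratio test of the simplex method: [t] is the least [c x / a x] over the points with
    [0 < a x], and [y] attains it. *)
Lemma min_ratio Y a c : supported Y a -> (exists x, 0 < a x) ->
  (forall x, 0 <= c x) ->
  exists t y, [/\ 0 <= t, forall x, 0 <= c x + - t * a x, 0 < a y
    & t * a y = c y].
Proof.
move=> sa [x0 ax0] c0; pose P := [fset x in Y | 0 < a x].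
have PP x : (x \in P) = (0 < a x).
  rewrite mem_fset_sep andb_idl // => ax; apply: (supported_mem sa).
  by rewrite gt_eqF.
have [|y] := @fset_argmax _ _ P (fun x => - (c x / a x)) x0; first by rewrite PP.
rewrite PP => ay hy.
have t0 : 0 <= c y / a y by rewrite divr_ge0 // ltW.
exists (c y / a y), y; split=> //; last by rewrite divfK // gt_eqF.
move=> x; rewrite mulNr subr_ge0; have [ax|ax] := leP (a x) 0.
  by apply: le_trans (c0 x); rewrite mulr_ge0_le0.
by rewrite -ler_pdivlMr // -lerN2 hy // PP.
Qed.

Lemma mindep_gt0 T c p : mindep T -> posdep T c -> p \in T -> 0 < c p.
Proof.
move=> [_ mT] [c0 sc cc cp] pT; rewrite lt_def c0 andbT; apply/eqP => cp0.
apply: (mT (T `\ p)); first exact: fproperD1.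
exists c; split=> // x; rewrite !inE negb_and negbK => /orP[/eqP->//|]; exact: sc.
Qed.

(** Subtracting from [c] the multiple of [a] given by the ratio test kills a coefficient inside [T]
    and keeps the others nonnegative, so by minimality nothing is left. *)
Lemma mindep_proportional T a c : mindep T -> posdep T c ->
  supported T a -> comb a = 0 -> exists k, forall x, a x = k * c x.
Proof.
move=> mT pc.
suff main b : supported T b -> comb b = 0 -> (exists x, 0 < b x) ->
    exists k, forall x, b x = k * c x.
  move=> sa ca; have [pa|/forallNP npa] := pselect (exists x, 0 < a x).
    exact: main.
  (* The negation of [a] is written [0 + -1 * a x] to fit the shape of [combDZ]. *)
  have [na|/forallNP nna] := pselect (exists x, 0 < 0 + -1 * a x).
    have [||//|k hk] := main (fun x => 0 + -1 * a x).
    - by move=> x /sa ->; rewrite mulr0 addr0.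
    - by rewrite combDZ ca scaler0 addr0 /comb big1 // => x _; rewrite scale0r.
    - by exists (- k) => x; rewrite mulNr -hk add0r mulN1r opprK.
  exists 0 => x; rewrite mul0r; apply/eqP; rewrite eq_le.
  move: (npa x) (nna x) => /negP; rewrite -leNgt => -> /negP.
  by rewrite -leNgt add0r mulN1r oppr_le0.
case: (pc) => c0 sc cc [x0 cx0] sb cb pb.
have [t [y [t0 ht by0 tby]]] := min_ratio sb pb c0.
have yT : y \in T by apply: (supported_mem sb); rewrite gt_eqF.
have c'0 x : c x = t * b x.
  apply/eqP; rewrite -subr_eq0 -mulNr; apply: contraT => nz.
  case: mT => _ /(_ (T `\ y) (fproperD1 yT)); case.
  exists (fun x => c x + - t * b x); split=> //.
  - move=> w; rewrite !inE negb_and negbK => /orP[/eqP->|wT].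
      by rewrite mulNr tby subrr.
    by rewrite sc // sb // mulr0 addr0.
  - by rewrite combDZ cc cb scaler0 addr0.
  - by exists x; rewrite lt_def nz ht.
have tn0 : t != 0 by apply: contraTneq cx0 => t00; rewrite c'0 t00 mul0r ltxx.
by exists t^-1 => x; rewrite c'0 mulKf.
Qed.

(** A relation on [T] is a multiple of the positive one, which does not vanish at [p]. *)
Lemma mindep_free T p a : mindep T -> p \in T ->
  supported (T `\ p) a -> comb a = 0 -> forall x, a x = 0.
Proof.
move=> mT pT sa ca; have [c pc] := mT.1.
have [k hk] := mindep_proportional mT pc (supportedS (fsubD1set T p) sa) ca.
suff k0 : k = 0 by move=> x; rewrite hk k0 mul0r.
have ap : a p = 0 by apply: sa; rewrite !inE eqxx.
apply/eqP; move/eqP: ap; rewrite hk mulf_eq0 => /orP[//|].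
by rewrite gt_eqF // (mindep_gt0 mT pc).
Qed.

(** * Bases of directions and half-spaces *)

Definition directions T : seq V := [seq x - z | x <- T].

Lemma comb_directions T a : T `<=` S -> supported T a ->
  comb a = \sum_(i < size (directions T)) a (nth z T i) *: (directions T)`_i.
Proof.
move=> TS sa; rewrite /comb -(big_fset_incl _ TS); last first.
  by move=> x _ /sa ->; rewrite scale0r.
rewrite (big_nth z) size_map big_mkord; apply: eq_bigr => i _.
by rewrite (nth_map z).
Qed.

Lemma total_directions T a : T `<=` S -> supported T a ->
  total a = \sum_(i < size (directions T)) a (nth z T i).
Proof.
move=> TS sa; rewrite /total -(big_fset_incl _ TS); last by move=> x _ /sa.
by rewrite (big_nth z) size_map big_mkord.
Qed.

(* When [directions T] is a basis, [level T] is the linear form equal to [1] on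
   it, so [beyond T] is the part of [S] in the closed half-space that is
   bounded by the hyperplane through [T] and does not contain [z]. *)
Definition level T (v : V) : R :=
  \sum_(i < size (directions T)) coord (in_tuple (directions T)) i v.

Lemma level_comb T a : level T (comb a) = \sum_(x <- S) a x * level T (x - z).
Proof.
rewrite /level /comb; under eq_bigr do rewrite linear_sum /=.
rewrite exchange_big /=; apply: eq_bigr => x _; rewrite mulr_sumr.
by apply: eq_bigr => i _; rewrite linearZ.
Qed.

Lemma level_total T a : T `<=` S -> free (directions T) -> supported T a ->
  level T (comb a) = total a.
Proof.
move=> TS fT sa; rewrite (comb_directions TS sa) (total_directions TS sa).
apply: eq_bigr => i _.
exact: (coord_sum_free (X := in_tuple (directions T)) (fun i => a (nth z T i))).
Qed.

Definition beyond T : {fset V} := [fset x in S | 1 <= level T (x - z)].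

(** The linear form [level T] is at least [1] on every direction involved, hence positive on any
    nontrivial nonnegative combination of them. *)
Lemma beyond_independent T : ~ dependent (beyond T).
Proof.
move=> [c [c0 sc cc [x0 cx0]]].
have : \sum_(x <- S) c x * level T (x - z) = 0.
  by rewrite -level_comb cc /level big1 // => i _; rewrite linear0.
apply/eqP; rewrite gt_eqF //.
have x0S : x0 \in S.
  suff: x0 \in beyond T by rewrite mem_fset_sep => /andP[].
  by apply: (supported_mem sc); rewrite gt_eqF.
have c_le x : c x <= c x * level T (x - z).
  have [xb|/sc->] := boolP (x \in beyond T); last by rewrite mul0r.
  rewrite ler_peMr //.
  by move: xb; rewrite mem_fset_sep => /andP[].
rewrite (big_fsetD1 x0) //=; apply: ltr_pwDl; first exact: lt_le_trans (c_le _).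
by apply: sumr_ge0 => x _; apply: le_trans (c_le _).
Qed.

(** The form in which general position enters this section; [general_position_span] supplies it. *)
Hypothesis dependent_span : forall Y, Y `<=` S -> dependent Y ->
  forall v, exists2 a, supported Y a & comb a = v.

(** A multiple of the positive dependence on [T] clears the coefficient at [p] without changing the
    combination. *)
Lemma mindep_span T p v : T `<=` S -> mindep T -> p \in T ->
  exists2 a, supported (T `\ p) a & comb a = v.
Proof.
move=> TS mT pT; have [c pc] := mT.1; have cp := mindep_gt0 mT pc pT.
have [a sa av] := dependent_span TS mT.1 v; case: pc => c0 sc cc _.
exists (fun x => a x + - (a p / c p) * c x); last first.
  by rewrite combDZ cc scaler0 addr0.
move=> x; rewrite !inE negb_and negbK => /orP[/eqP->|xT].
  by rewrite mulNr divfK ?subrr // gt_eqF.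
by rewrite (sa x) // (sc x) // mulr0 addr0.
Qed.

Lemma mindep_directions_free T p : T `<=` S -> mindep T -> p \in T ->
  free (directions (T `\ p)).
Proof.
move=> TS mT pT; set s := T `\ p.
have sS : s `<=` S by apply: fsubset_trans TS; exact: fsubD1set.
change (free (in_tuple (directions s))); apply/freeP => k hk i.
(* This transports [k] from positions in the list [s] to points, with value [0] off [s]. *)
pose a x := if x \in s then oapp k 0 (insub (index x s)) else 0.
have sa : supported s a by move=> x xs; rewrite /a (negPf xs).
have ak (j : 'I_(size (directions s))) : a (nth z s j) = k j.
  have js : (j < size s)%N by case: j => j /=; rewrite size_map.
  by rewrite /a mem_nth // index_uniq // ?fset_uniq // valK.
rewrite -ak; apply: (mindep_free mT pT sa).
by rewrite (comb_directions sS sa) -[RHS]hk; apply: eq_bigr => j _; rewrite ak.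
Qed.

(** Dropping one point [p] leaves a basis of directions: free by minimality, spanning by
    [dependent_span]. *)
Lemma card_mindep T : T `<=` S -> mindep T -> #|` T| = (dim V).+1.
Proof.
move=> TS mT; have [c pc] := mT.1; have [_ sc _ [p cp]] := pc.
have pT : p \in T by apply: (supported_mem sc); rewrite gt_eqF.
have sS : T `\ p `<=` S by apply: fsubset_trans TS; exact: fsubD1set.
have bs : basis_of fullv (in_tuple (directions (T `\ p))).
  rewrite /basis_of mindep_directions_free // andbT eqEsubv subvf.
  apply/subvP => v _; have [a sa <-] := mindep_span v TS mT pT.
  rewrite (comb_directions sS sa); apply: memv_suml => i _; apply: memvZ.
  by apply: memv_span; apply: mem_nth.
by rewrite (cardfsD1 p) pT -dimvf (size_basis bs) size_map.
Qed.

(* This is the simplex method for maximising [total c] over the dependences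
   [c] on [p |` X] normalised by [c p = 1]: at an optimal basis [T], a point
   of [X] not beyond [T `\ p] could enter the basis and improve the objective. *)
Lemma maximal_independent_beyond X p : X `<=` S -> ~ dependent X ->
  (forall Y, Y `<=` S -> X `<` Y -> dependent Y) -> p \in S -> p \notin X ->
  exists T, [/\ T `<=` S, mindep T, p \in T & X = beyond (T `\ p)].
Proof.
move=> XS iX mX pS pX.
have pXS : p |` X `<=` S by rewrite fsubUset fsub1set pS.
have [T0 T0X mT0] : exists2 T, T `<=` p |` X & mindep T.
  by apply: dependent_mindep; apply: mX => //; rewrite fproperUr // fsub1set.
pose F := [fset T in fpowerset (p |` X) | `[< mindep T >]].
have FP T : T \in F <-> T `<=` p |` X /\ mindep T.
  by rewrite mem_fset_sep fpowersetE; split=> [/andP[-> /asboolP]|[-> /asboolT]].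
have FpT T : T \in F -> p \in T.
  move=> /FP[TX mT]; apply: contra_notT iX => pT.
  apply: dependentS mT.1; apply/fsubsetP => x xT.
  move/fsubsetP: TX => /(_ x xT); rewrite !inE => /orP[/eqP xp|//].
  by rewrite -xp xT in pT.
(* For [T] in [F] the dependence with [c p = 1] is unique, so [g T] is its total. The barycentric
   coordinate of [z] at [p] is [1 / g T], which is why [g] is maximised. *)
pose g T := xget 0 [set r | exists c, [/\ posdep T c, c p = 1 & total c = r]]%classic.
have gE T c : T \in F -> posdep T c -> c p = 1 -> g T = total c.
  move=> TF pc cp; apply: xget_unique; first by exists c.
  move=> r [c' [[c'0 sc' cc' _] c'p <-]]; have [_ mT] := (FP T).1 TF.
  have [k hk] := mindep_proportional mT pc sc' cc'.
  have k1 : k = 1 by rewrite -c'p hk cp mulr1.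
  by apply: eq_bigr => x _; rewrite hk k1 mul1r.
have [|T TF gT] := @fset_argmax _ _ F g T0; first exact/FP.
have [TX mT] := (FP T).1 TF; have pT := FpT T TF.
have TS := fsubset_trans TX pXS.
have fs := mindep_directions_free TS mT pT.
have sS : T `\ p `<=` S by apply: fsubset_trans TS; exact: fsubD1set.
have [c [pc cp1]] : exists c, posdep T c /\ c p = 1.
  have [c pc] := mT.1; have cp := mindep_gt0 mT pc pT.
  case: pc => c0 sc cc [x cx]; exists (fun x => 0 + (c p)^-1 * c x).
  split; last by rewrite add0r mulVf // gt_eqF.
  split.
  - by move=> y; rewrite add0r mulr_ge0 // invr_ge0.
  - by move=> y /sc ->; rewrite mulr0 addr0.
  - by rewrite combDZ cc scaler0 addr0 /comb big1 // => y _; rewrite scale0r.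
  - by exists x; rewrite add0r mulr_gt0 // invr_gt0.
have Xb : X `<=` beyond (T `\ p).
  apply/fsubsetP => x xX; have xS := fsubsetP XS x xX.
  rewrite mem_fset_sep xS /= leNgt; apply/negP => lx.
  have xp : x != p by apply: contraNneq pX => <-.
  have [al sal xal] := mindep_span (x - z) TS mT pT.
  have tal : total al < 1 by rewrite -(level_total sS fs sal) xal.
  (* The pivot direction: [x - z] is expressed in the basis [T] without [p], so moving along [-a]
     lets [x] enter while the coefficient at [p] stays fixed. *)
  pose a y := al y + -1 * (y == x)%:R.
  have ca : comb a = 0.
    by rewrite combDZ xal comb_indicator // scaleN1r subrr.
  have ta : total a < 0 by rewrite totalDZ total_indicator // mulr1 subr_lt0.
  have ap : a p = 0.
    by rewrite /a sal ?inE ?eqxx // eq_sym (negPf xp) mulr0 addr0.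
  have sa : supported (x |` T `\ p) a.
    move=> y; rewrite in_fset1U negb_or => /andP[/negPf yx /sal ys].
    by rewrite /a ys yx mulr0 addr0.
  have sX : x |` T `\ p `<=` X.
    rewrite fsubUset fsub1set xX /=; apply/fsubsetP => y; rewrite !inE.
    move=> /andP[/negPf yp yT]; move/fsubsetP: TX => /(_ y yT).
    by rewrite !inE yp.
  (* Otherwise [-a], whose total is positive, would be a positive dependence on [X]; thus the pivot
     step is bounded. *)
  have pa : exists y, 0 < a y.
    apply: contra_notP iX => /forallNP na.
    exists (fun y => 0 + -1 * a y); split.
    - by move=> y; rewrite add0r mulN1r oppr_ge0 leNgt; apply/negP.
    - by move=> y yX; rewrite (supportedS sX sa) // mulr0 addr0.
    - by rewrite combDZ ca scaler0 addr0 /comb big1 // => y _; rewrite scale0r.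
    - apply: contrapT => /forallNP nn; move: ta; apply/negP; rewrite -leNgt.
      apply: sumr_ge0 => y _; move: (nn y) => /negP.
      by rewrite -leNgt add0r mulN1r oppr_le0.
  have [c0 sc cc _] := pc.
  have [t [y [t0 c'0 ay tay]]] := min_ratio sa pa c0.
  have yT : y \in T.
    apply: contraTT ay => yT; rewrite -leNgt /a sal ?add0r ?mulN1r ?oppr_le0 //.
    by rewrite !inE (negPf yT) andbF.
  have tp : 0 < t.
    by rewrite -(pmulr_lgt0 _ ay) tay (mindep_gt0 mT).
  pose c' w := c w + - t * a w; pose Y := (x |` T) `\ y.
  have c'p : c' p = 1 by rewrite /c' ap mulr0 addr0.
  have pc' : posdep Y c'.
    split=> //; last by exists p; rewrite c'p.
      move=> w; rewrite !inE negb_and negbK negb_or.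
      move=> /orP[/eqP->|/andP[wx wT]].
        by rewrite /c' mulNr tay subrr.
      rewrite /c' sc // sa ?mulr0 ?addr0 //.
      by rewrite !inE (negPf wx) (negPf wT) andbF.
    by rewrite combDZ cc ca scaler0 addr0.
  have YX : Y `<=` p |` X.
    apply/fsubsetP => w; rewrite !inE => /andP[_ /orP[/eqP->|wT]].
      by rewrite xX orbT.
    by move/fsubsetP: TX => /(_ w wT); rewrite !inE.
  have [T' T'Y mT'] : exists2 T', T' `<=` Y & mindep T'.
    by apply: dependent_mindep; exists c'.
  have T'X := fsubset_trans T'Y YX.
  (* [Y] has at most as many points as [T], and all minimal dependent sets have the same size. *)
  have T'E : T' = Y.
    apply/eqP; rewrite eqEfcard T'Y /=.
    rewrite (card_mindep (fsubset_trans T'X pXS)) // -(card_mindep TS mT).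
    have := cardfsD1 y (x |` T); rewrite -/Y !inE yT orbT cardfsU1 add1n.
    by move=> cY; rewrite -ltnS -cY -[leqRHS]add1n leq_add2r leq_b1.
  have YF : Y \in F by apply/FP; rewrite -T'E.
  (* The pivot changes the objective by [- t * total a], which is positive, against the optimality
     of [T]. *)
  have := gT _ YF; rewrite (gE _ _ YF pc' c'p) (gE _ _ TF pc cp1) totalDZ.
  by rewrite gerDl mulNr oppr_le0 pmulr_rge0 // leNgt ta.
exists T; split=> //; case: (eqVfproper Xb) => // Xp.
case: (@beyond_independent (T `\ p)); apply: mX => //.
by apply/fsubsetP => x; rewrite mem_fset_sep => /andP[].
Qed.

End PositiveDependence.

(** * Convex hulls and their interior points *)

Section ConvexHull.
Variables (R : realType) (d : nat).
Local Notation V := 'rV[R]_d.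
Implicit Types (S T X Y : {fset V}) (z : V) (A : set V) (a c : V -> R).
Local Open Scope classical_set_scope.

Lemma convex_set_avg A (x y : V) (t : R) : @convex_set R V A ->
  A x -> A y -> 0 <= t <= 1 -> A (t *: x + (1 - t) *: y).
Proof.
move=> cA Ax Ay t01.
have := cA x y (Itv01 (andP t01).1 (andP t01).2).
by rewrite !inE; apply.
Qed.

(** Induction on [s]: the normalised sum averages the head with the normalised tail. Membership in
    [A] is asked only where [c x != 0], so that [s] may be all of [S]. *)
Lemma convex_set_sum A (s : seq V) (c : V -> R) : @convex_set R V A ->
  (forall x, 0 <= c x) -> (forall x, x \in s -> c x != 0 -> A x) ->
  0 < \sum_(x <- s) c x ->
  A ((\sum_(x <- s) c x)^-1 *: \sum_(x <- s) c x *: x).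
Proof.
move=> cA c0; elim: s => [|x s IH] sA; first by rewrite big_nil ltxx.
rewrite !big_cons; set k := \sum_(y <- s) c y; set w := \sum_(y <- s) _ => kp.
have sA' y : y \in s -> c y != 0 -> A y.
  by move=> ys; apply: sA; rewrite inE ys orbT.
have k0 : 0 <= k by apply: sumr_ge0.
have [cx|cx] := eqVneq (c x) 0.
  by rewrite cx scale0r !add0r; apply: IH => //; rewrite cx add0r in kp.
have cxp : 0 < c x by rewrite lt_def cx c0.
have Ax : A x by apply: sA; rewrite ?mem_head.
have [kz|kz] := eqVneq k 0.
  have -> : w = 0.
    rewrite /w big_seq big1 // => y ys.
    move/eqP: kz; rewrite psumr_eq0 // => /allP /(_ y ys) /eqP ->.
    by rewrite scale0r.
  by rewrite kz !addr0 scalerA mulVf // scale1r.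
have kp' : 0 < k by rewrite lt_def kz k0.
have ne : c x + k != 0 by rewrite gt_eqF.
have := @convex_set_avg A x (k^-1 *: w) (c x / (c x + k)) cA Ax (IH sA' kp').
have -> : 1 - c x / (c x + k) = k / (c x + k) by field.
have -> : k / (c x + k) *: (k^-1 *: w) = (c x + k)^-1 *: w.
  by rewrite scalerA mulrAC divff // mul1r.
rewrite divr_ge0 ?ler_pdivrMr ?mul1r ?lerDl // ?ltW //= => /(_ isT).
by rewrite scalerDr scalerA [_^-1 * _]mulrC.
Qed.

Lemma conv_hullS X Y : (X `<=` Y)%fset ->
  conv_hull [set` X] `<=` conv_hull [set` Y].
Proof.
move=> /fsubsetP XY v hv B [cB YB]; apply: hv; split=> // x /= xX.
exact/YB/XY.
Qed.

Lemma z_containingS z X Y : (X `<=` Y)%fset ->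
  z_containing z X -> z_containing z Y.
Proof. by move=> XY; apply: interiorS; exact: conv_hullS. Qed.

Lemma comb_sum S z n (k : 'I_n -> R) (f : 'I_n -> V -> R) :
  comb S z (fun x => \sum_i k i * f i x) = \sum_i k i *: comb S z (f i).
Proof.
rewrite /comb; under [RHS]eq_bigr do rewrite scaler_sumr.
rewrite exchange_big /=; apply: eq_bigr => x _; rewrite scaler_suml.
by apply: eq_bigr => i _; rewrite scalerA.
Qed.

Lemma combE S z c : comb S z c = \sum_(x <- S) c x *: x - total S c *: z.
Proof.
rewrite /comb /total scaler_suml -sumrB.
by apply: eq_bigr => x _; rewrite scalerBr.
Qed.

(** The convex combinations of [X], with coefficients indexed by [S], form a convex set containing
    [X], hence its hull; writing [z] as one of them gives the dependence. *)
Lemma z_containing_dependent S z X : (X `<=` S)%fset ->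
  z_containing z X -> dependent S z X.
Proof.
move=> XS /interior_subset zX.
pose H : set V := [set v | exists c, [/\ forall x, 0 <= c x, supported X c,
  total S c = 1 & \sum_(x <- S) c x *: x = v]].
have : H z.
  apply: (smallest_sub _ _ zX).
    move=> u v t; rewrite !inE => -[c1 [c10 s1 t1 <-]] [c2 [c20 s2 t2 <-]].
    have t0 : 0 <= t%:num by [].
    have t1' : 0 <= 1 - t%:num by rewrite subr_ge0.
    exists (fun x => t%:num * c1 x + (1 - t%:num) * c2 x); split.
    - by move=> x; rewrite addr_ge0 // mulr_ge0.
    - by move=> x xX; rewrite s1 // s2 // !mulr0 addr0.
    - by rewrite totalDZ t2 mulr1 /total -mulr_sumr -/(total S c1) t1; ring.
    - under eq_bigr do rewrite scalerDl -!scalerA.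
      by rewrite big_split /= -!scaler_sumr.
  move=> x /= xX; have xS := fsubsetP XS x xX.
  exists (fun y => (y == x)%:R); split.
  - by move=> y; rewrite ler0n.
  - by move=> y yX; case: eqP => // yx; rewrite yx xX in yX.
  - exact: total_indicator.
  - by have := comb_indicator 0 xS; rewrite combE scaler0 !subr0.
move=> [c [c0 sc tc cz]]; exists c; split=> //.
  by rewrite combE cz tc scale1r subrr.
apply: contrapT => /forallNP nc.
have : total S c <= 0 by apply: sumr_le0 => x _; rewrite leNgt; apply/negP.
by rewrite tc ler10.
Qed.

Lemma mem_conv_hull S z T c : (T `<=` S)%fset -> (forall x, 0 <= c x) ->
  supported T c -> total S c = 1 -> conv_hull [set` T] (z + comb S z c).
Proof.
move=> TS c0 sc tc B [cB TB].
rewrite combE tc scale1r addrCA subrr addr0.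
have := @convex_set_sum B S c cB c0; rewrite -/(total S c) tc invr1 scale1r.
apply=> // x _ cx; apply: TB; exact: supported_mem cx.
Qed.

Lemma rV_coord_le_norm (u : V) j : `|u 0 j| <= `|u|.
Proof.
rewrite [leRHS]/Num.norm /= mx_normrE; apply/bigmax_geP; right => /=.
by exists (0, j).
Qed.

(** [z] has strictly positive barycentric coordinates on [T], and spanning lets any small
    displacement of [z] be absorbed by a small change of these coordinates. *)
Lemma spanning_mindep_containing S z T : (T `<=` S)%fset -> mindep S z T ->
  (forall v, exists2 a, supported T a & comb S z a = v) -> z_containing z T.
Proof.
move=> TS mT spT; have [c [pc tc]] : exists c, posdep S z T c /\ total S c = 1.
  have [c [c0 sc cc [p cp]]] := mT.1.
  have pS : p \in S.
    by apply: (fsubsetP TS); apply: (supported_mem sc); rewrite gt_eqF.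
  have tp : 0 < total S c.
    rewrite /total (big_fsetD1 p) //= ltr_pwDl // sumr_ge0 //.
  exists (fun x => 0 + (total S c)^-1 * c x); split; last first.
    by rewrite totalDZ mulVf ?gt_eqF // /total big1 // add0r.
  split.
  - by move=> x; rewrite add0r mulr_ge0 // invr_ge0 ltW.
  - by move=> x /sc ->; rewrite mulr0 addr0.
  - rewrite combDZ cc scaler0 addr0 /comb big1 // => x _; exact: scale0r.
  - by exists p; rewrite add0r mulr_gt0 // invr_gt0.
have cgt0 x : x \in T -> 0 < c x by exact: (mindep_gt0 mT pc).
case: (pc) => c0 sc cc [p cp].
have pT : p \in T by apply: (supported_mem sc); rewrite gt_eqF.
have [q qT cq] := fset_argmax (fun x => - c x) pT.
have c_ge x : x \in T -> c q <= c x by move=> /cq; rewrite lerN2.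
have c_le1 x : c x <= 1.
  have [xS|xS] := boolP (x \in S).
    by rewrite -tc /total (big_fsetD1 x) //= lerDl sumr_ge0.
  by rewrite sc ?ler01 //; apply: contra xS; exact: (fsubsetP TS).
have /choice[a ha] : forall j : 'I_d, exists a,
    supported T a /\ comb S z a = delta_mx 0 j.
  by move=> j; have [a sa aj] := spT (delta_mx 0 j); exists a.
(* [M] bounds the sum of the absolute coefficients needed for a displacement of norm [1]; the
   summand [1] keeps it positive. *)
pose M := 1 + \sum_(x <- S) \sum_j `|a j x|.
have M_gt0 : 0 < M.
  by rewrite ltr_pwDl // sumr_ge0 // => x _; rewrite sumr_ge0.
(* The factor [2] pays for two errors of size at most [M] times the norm of [u]: the change [b x]
   and the correction [total S b * c x]. Together they stay below the least coefficient [c q]. *)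
apply/(@nbhs_normP R V z); exists (c q / (2 * M)).
  by rewrite /= divr_gt0 ?mulr_gt0 // cgt0.
move=> w /=; rewrite distrC => wz; set u := w - z in wz.
pose b x := \sum_j u 0 j * a j x.
have sb : supported T b.
  by move=> x xT; rewrite /b big1 // => j _; rewrite (ha j).1 // mulr0.
have cb : comb S z b = u.
  rewrite comb_sum [RHS]row_sum_delta.
  by apply: eq_bigr => j _; rewrite (ha j).2.
have b_le x : `|b x| <= `|u| * \sum_j `|a j x|.
  rewrite mulr_sumr; apply: le_trans (ler_norm_sum _ _ _) _.
  apply: ler_sum => j _; rewrite normrM ler_wpM2r //.
  exact: rV_coord_le_norm.
have sb_le : \sum_(x <- S) `|b x| <= `|u| * M.
  apply: (@le_trans _ _ (`|u| * \sum_(x <- S) \sum_j `|a j x|)).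
    by rewrite mulr_sumr; apply: ler_sum.
  by rewrite ler_wpM2l // lerDr.
have uM : `|u| * M * 2 <= c q.
  by rewrite -mulrA [M * 2]mulrC -ler_pdivlMr ?mulr_gt0 // ltW.
(* Adding a multiple of [c] restores total [1] and leaves the combination equal to [u]. *)
pose g x := b x + (1 - total S b) * c x.
have -> : w = z + comb S z g.
  by rewrite combDZ cb cc scaler0 addr0 /u addrCA subrr addr0.
apply: mem_conv_hull => //; last first.
- by rewrite totalDZ tc mulr1 addrCA subrr addr0.
- by move=> x xT; rewrite /g sb // sc // mulr0 addr0.
move=> x; have [xT|xT] := boolP (x \in T); last first.
  by rewrite /g sb // sc // mulr0 addr0.
have bx : `|b x| <= `|u| * M.
  apply: le_trans sb_le; rewrite (big_fsetD1 x) /= ?(fsubsetP TS) //.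
  by rewrite lerDl sumr_ge0.
have tb : `|total S b| <= `|u| * M by apply: le_trans (ler_norm_sum _ _ _) sb_le.
have tbc : total S b * c x <= `|u| * M.
  apply: le_trans (ler_norm _) _; rewrite normrM (ger0_norm (c0 x)).
  by rewrite -[leRHS]mulr1 ler_pM.
have := ler_norm (- b x); rewrite normrN /g mulrBl mul1r.
have := c_ge x xT; lra.
Qed.

End ConvexHull.

(** * Affine hulls and general position *)

Section GeneralPosition.
Variables (R : realType) (d : nat).
Local Notation V := 'rV[R]_d.
Implicit Types (S T X Y : {fset V}) (z : V) (a c : V -> R).
Local Open Scope classical_set_scope.

Lemma translate_direction_sub (p q : V) (U W : {vspace V}) :
  translate p U = translate q W -> (U <= W)%VS.
Proof.
move=> e; apply/subvP => u uU.
have [w0 /= w0W e0] : translate q W (p + 0).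
  by rewrite -e; exists 0 => //=; exact: mem0v.
have [w1 /= w1W e1] : translate q W (p + u) by rewrite -e; exists u.
have -> : u = w1 - w0.
  by apply: (addrI p); rewrite -e1 -[p in RHS]addr0 -e0 addrACA subrr addr0.
exact: memvB.
Qed.

Lemma directionE (p : V) (U : {vspace V}) : direction (translate p U) = U.
Proof.
apply: xget_unique; first by exists p.
move=> W [q e]; apply/eqP; rewrite eqEsubv.
by rewrite (translate_direction_sub e) (translate_direction_sub (esym e)).
Qed.

(** A positive dependence makes [z] a convex combination of [Y], so every affine subspace containing
    [Y] contains [z], which can serve as its base point. *)
Lemma affine_hull_dependent S z Y : (Y `<=` S)%fset -> dependent S z Y ->
  affine_hull [set` Y] = translate z <<directions z Y>>%VS.
Proof.
move=> YS [c [c0 sc cc [p cp]]].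
have pY : p \in Y by apply: (supported_mem sc); rewrite gt_eqF.
have tp : 0 < total S c.
  by rewrite /total (big_fsetD1 p) ?(fsubsetP YS) //= ltr_pwDl // sumr_ge0.
apply/seteqP; split.
  apply: smallest_sub; first by right; exists z, <<directions z Y>>%VS.
  move=> y /= yY; exists (y - z); last by rewrite addrC subrK.
  by apply: memv_span; apply: map_f.
move=> _ [u /= uU <-] A [[A0|[q [W AE]]] YA]; first by have := YA p pY; rewrite A0.
have YW y : y \in Y -> y - q \in W.
  move=> yY; have := YA y yY; rewrite AE => -[w /= wW <-].
  by rewrite addrAC subrr add0r.
(* With base point [q] in place of [z], the vanishing combination becomes [total S c *: (z - q)]. *)
have zW : z - q \in W.
  have : comb S q c = total S c *: (z - q).
    move: cc; rewrite !combE scalerBr => /eqP; rewrite subr_eq0 => /eqP ->.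
    by [].
  move=> /(congr1 (fun v => (total S c)^-1 *: v)).
  rewrite scalerA mulVf ?gt_eqF // scale1r => <-.
  apply: memvZ; apply: memv_suml => x _.
  have [xY|xY] := boolP (x \in Y); first by apply: memvZ; exact: YW.
  by rewrite sc // scale0r mem0v.
rewrite AE; exists (z - q + u); last by rewrite addrA [q + _]addrC subrK.
apply: memvD => //; apply: (subvP _ _ uU); apply/span_subvP => _ /mapP[y yY ->].
have -> : y - z = (y - q) - (z - q) by rewrite opprB addrA subrK.
by apply: memvB => //; exact: YW.
Qed.

(** The affine hull of [Y] passes through [z], so general position forces it to have dimension
    [d]. *)
Lemma general_position_span S z : general_position z S ->
  forall Y, (Y `<=` S)%fset -> dependent S z Y ->
  forall v, exists2 a, supported Y a & comb S z a = v.
Proof.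
move=> gp Y YS dY v; have := gp Y YS; rewrite (affine_hull_dependent YS dY).
set U := <<_>>%VS => dimU.
have zU : translate z U z by exists 0; rewrite ?addr0 //=; exact: mem0v.
have {dimU} dU : (d <= \dim U)%N.
  rewrite leqNgt; apply/negP => lt; apply: dimU zU.
  rewrite /affine_dim directionE; by case: eqP.
have vU : v \in <<in_tuple (directions z Y)>>%VS.
  have -> : <<in_tuple (directions z Y)>>%VS = fullv.
    apply/eqP; rewrite eqEdim subvf /= dimvf.
    by rewrite [dim _]mul1n.
  exact: memvf.
have nY (i : 'I_(size (directions z Y))) : nth z Y i \in Y.
  by rewrite mem_nth //; case: i => i /=; rewrite size_map.
exists (fun x => \sum_(i < size (directions z Y))
    coord (in_tuple (directions z Y)) i v * (x == nth z Y i)%:R).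
  move=> x xY; rewrite big1 // => i _; case: eqP => [xi|]; last by rewrite mulr0.
  by move: (nY i); rewrite -xi (negPf xY).
rewrite comb_sum [RHS](coord_span vU); apply: eq_bigr => i _.
rewrite comb_indicator ?(fsubsetP YS) // (nth_map z) //.
by case: i => i /=; rewrite size_map.
Qed.

(** For the converse, a minimal dependent subset of [X] already has [z] in the interior of its
    hull. *)
Lemma z_containingP S z X : general_position z S -> (X `<=` S)%fset ->
  z_containing z X <-> dependent S z X.
Proof.
move=> gp XS; split; first exact: z_containing_dependent.
move=> /dependent_mindep[T TX mT]; apply: (z_containingS TX).
have TS := fsubset_trans TX XS.
apply: (spanning_mindep_containing TS mT) => v.
exact: general_position_span mT.1 v.
Qed.

End GeneralPosition.

Theorem theorem1p2 (R : realType) (d : nat) (S : {fset 'rV[R]_d})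
    (z : 'rV[R]_d) (hzS : z \notin S) (hgen : general_position z S) :
  (#|` maximal_avoiding_sets z S | <= d * #|` minimal_containing_sets z S | + 1)%N.
Proof.
have spS := general_position_span hgen.
have CP T : T \in minimal_containing_sets z S <-> T `<=` S /\ mindep S z T.
  rewrite mem_fset_sep fpowersetE; split.
    move=> /andP[TS /asboolP[cT mT]]; split=> //; split.
      exact/(z_containingP hgen TS).
    move=> Y YT dY; apply: (mT Y YT); apply/(z_containingP hgen) => //.
    exact: fsubset_trans (fproper_sub YT) TS.
  move=> [TS [dT mT]]; rewrite TS; apply/asboolP; split.
    exact/(z_containingP hgen TS).
  move=> Y YT cY; apply: (mT Y YT); apply/(z_containingP hgen) => //.
  exact: fsubset_trans (fproper_sub YT) TS.
have AP X : X \in maximal_avoiding_sets z S -> [/\ X `<=` S,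
    ~ dependent S z X & forall Y, Y `<=` S -> X `<` Y -> dependent S z Y].
  rewrite mem_fset_sep fpowersetE => /andP[XS /asboolP[aX mX]]; split=> //.
    by move=> dX; apply: aX; apply/(z_containingP hgen XS).
  move=> Y YS XY; apply/(z_containingP hgen YS).
  exact: contrapT (mX Y YS XY).
have [S0|[p pS]] := fset_0Vmem S.
  apply: (@leq_trans #|` fpowerset S|).
    by apply: fsubset_leq_card; apply/fsubsetP => X; rewrite mem_fset_sep => /andP[].
  by rewrite card_fpowerset S0 cardfs0; lia.
apply: (@card_maximal_avoiding_le _ _ S).
(* In dimension [0] all points coincide, so [p \in S] would give [z \in S]. *)
- case: d S z hzS hgen spS CP AP p pS => // S z hzS _ _ _ _ p pS.
  by case/negP: hzS; rewrite (thinmx0 z) -(thinmx0 p).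
- move=> T /CP[TS mT]; split=> //.
  by rewrite (card_mindep spS TS mT) [dim _]mul1n.
- by move=> X /AP[].
- move=> X T /AP[_ iX _] /CP[_ [dT _]]; apply: contra_notN iX => TX.
  exact: dependentS TX dT.
- move=> X Y /AP[_ _ mX] YS XY nC; case: (eqVfproper XY) => // /(mX Y YS).
  move=> /dependent_mindep[T TY mT].
  have /CP/nC : T `<=` S /\ mindep S z T by split=> //; exact: fsubset_trans YS.
  by rewrite TY.
move=> q qS; rewrite !sum_mem_fset.
pose Cq := [fset T : {fset _} in minimal_containing_sets z S | q \in T].
apply: (@leq_trans #|` [fset beyond S z (T `\ q) | T in Cq]|); last first.
  exact: leq_imfset_card.
apply: fsubset_leq_card; apply/fsubsetP => X; rewrite mem_fset_sep.
move=> /andP[/AP[XS iX mX] qX].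
have [T [TS mT qT ->]] := maximal_independent_beyond spS XS iX mX qS qX.
by apply/imfsetP; exists T => //=; rewrite mem_fset_sep qT andbT; apply/CP.
Qed.
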